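(* For all $n\ge 1$, $|F_n(321,21354)|=2^n-\binom{n}{2}-1$.
   Context: A permutation $\pi$ avoids a classical pattern $p\in S_k$ if no subsequence of $\pi$ of length $k$ is order-isomorphic to $p$. A Fishburn permutation is a permutation $\pi=\pi_1\cdots\pi_n$ of $[n]$ for which there are no indices $i<j$ with $\pi_j<\pi_i<\pi_{i+1}$ and $\pi_i=\pi_j+1$. $F_n(\sigma_1,\dots,\sigma_k)$ denotes the set of Fishburn permutations of length $n$ avoiding each of the classical patterns $\sigma_1,\dots,\sigma_k$. *)

(* Defs.v *)
From mathcomp Require Import all_boot all_order all_fingroup.
Set Implicit Arguments. Unset Strict Implicit. Unset Printing Implicit Defensive.

(* A permutation of [n] is represented as s : 'S_n, i.e. a permutation of
   {0,...,n-1}; pi_i (1-based) corresponds to s (i-1) + 1.  Order relations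
   are unchanged by this shift. *)

(* Classical pattern containment: the pattern p (given as the sequence of its
   values, e.g. [:: 3;2;1] for 321) occurs in s iff there is a strictly
   increasing choice of positions f : 'I_k -> 'I_n such that the subsequence
   s (f 0), ..., s (f (k-1)) is order-isomorphic to p. *)
Definition contains (n : nat) (s : 'S_n) (p : seq nat) : bool :=
  [exists f : {ffun 'I_(size p) -> 'I_n},
     [forall i : 'I_(size p), forall j : 'I_(size p),
        ((i < j)%N ==> (f i < f j)%N) &&
        ((s (f i) < s (f j))%N == (nth 0 p i < nth 0 p j)%N)]].

Definition avoids (n : nat) (s : 'S_n) (p : seq nat) : bool := ~~ contains s p.

Definition fishburn (n : nat) (s : 'S_n) : bool :=
  ~~ [exists i : 'I_n, exists j : 'I_n, exists i1 : 'I_n,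
       [&& (i < j)%N, val i1 == i.+1,
           (s j < s i)%N, (s i < s i1)%N & (val (s i) == (s j).+1)]].

Definition F_321_21354 (n : nat) : {set 'S_n} :=
  [set s : 'S_n | [&& fishburn s, avoids s [:: 3; 2; 1] & avoids s [:: 2; 1; 3; 5; 4]]].

(* Main.v *)
Require Import Defs.
From mathcomp Require Import all_boot all_order all_fingroup.
From mathcomp Require Import zify.

Set Implicit Arguments.
Unset Strict Implicit.
Unset Printing Implicit Defensive.

(* Deleting a leading minimum or a trailing maximum preserves membership in
   F_n(321, 21354), so with h_n the number of members having neither,
   f_(n+2) = 2 f_(n+1) - f_n + h_(n+2), and it remains to see h_(n+2) = 2^n - 1.

   Let p (0-based) have neither, and put a = p 0.  The Fishburn condition at
   place 0 forces p 1 = 0, so the values above a avoid 132.  Write D for the set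
   of left-to-right maxima, j for the truncated difference (last value) - a, and
   b = a + j.  Then the values on D are a and everything above b, and the last j
   places carry a+1, ..., b; as p is increasing on D and off D, it is determined
   by (j, D).  For j = 0 the set D is arbitrary on the places 2, ..., n-2; for
   j > 0 it is a nonempty set of places in 2, ..., n-1-j which, by the Fishburn
   condition at the value b + 1, does not contain the successor of its least
   element. *)

(** * Permutations as functions on natural numbers *)

Definition natperm (n : nat) (p : nat -> nat) : Prop :=
  [/\ forall i, i < n -> p i < n,
      forall i k, i < n -> k < n -> p i = p k -> i = k
    & forall v, v < n -> exists2 i, i < n & p i = v].

(** As [i < k < n], the place [i.+1] is in range, and for injective [p] the absence of an ascent
    there is a strict descent. *)
Definition nat_fishburn (n : nat) (p : nat -> nat) : Prop :=
  forall i k, i < k -> k < n -> p i = (p k).+1 -> p i.+1 < p i.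

Definition no321 (n : nat) (p : nat -> nat) : Prop :=
  forall i j k, i < j -> j < k -> k < n -> p k < p j -> p j < p i -> False.

Definition no21354 (n : nat) (p : nat -> nat) : Prop :=
  forall x1 x2 x3 x4 x5, x1 < x2 -> x2 < x3 -> x3 < x4 -> x4 < x5 -> x5 < n ->
    p x2 < p x1 -> p x1 < p x3 -> p x3 < p x5 -> p x5 < p x4 -> False.

Definition in_F (n : nat) (p : nat -> nat) : Prop :=
  [/\ nat_fishburn n p, no321 n p & no21354 n p].

Definition valn (n : nat) (s : 'S_n.+1) (i : nat) : nat := s (inord i).

Lemma valn_ord n (s : 'S_n.+1) (i : 'I_n.+1) : valn s i = s i.
Proof. by rewrite /valn inord_val. Qed.

Lemma valn_inj n (s t : 'S_n.+1) :
  (forall i, i < n.+1 -> valn s i = valn t i) -> s = t.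
Proof.
by move=> H; apply/permP => i; apply/val_inj; rewrite /= -!valn_ord; apply: H.
Qed.

Lemma natperm_valn n (s : 'S_n.+1) : natperm n.+1 (valn s).
Proof.
split=> [i _ | i k ltin ltkn | v ltvn]; first exact: ltn_ord.
  by move/val_inj/perm_inj/(congr1 val) => /=; rewrite !inordK.
exists ((s^-1)%g (inord v)); first exact: ltn_ord.
by rewrite valn_ord permKV inordK.
Qed.

Lemma perm_of_nat n (p : nat -> nat) :
  (forall i, i < n.+1 -> p i < n.+1) ->
  (forall i k, i < k -> k < n.+1 -> p i = p k -> False) ->
  exists s : 'S_n.+1, forall i, i < n.+1 -> valn s i = p i.
Proof.
move=> bnd inj.
pose f (i : 'I_n.+1) : 'I_n.+1 := inord (p i).
have fE i : f i = p i :> nat by rewrite inordK // bnd.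
have f_inj : injective f.
  move=> i k /(congr1 val); rewrite /= !fE => e; apply/val_inj => /=.
  by case: (ltngtP i k) => // l; [case: (inj i k) | case: (inj k i)].
by exists (perm f_inj) => i ltin; rewrite /valn permE fE inordK.
Qed.

Lemma contains321P n (s : 'S_n.+1) :
  reflect (exists i j k, [/\ i < j, j < k, k < n.+1, valn s k < valn s j
             & valn s j < valn s i]) (contains s [:: 3; 2; 1]).
Proof.
apply: (iffP existsP) => [[f /forallP H]|[i] [j] [k] [ij jk kn vkj vji]].
  pose o k (h : k < 3) : 'I_(size [:: 3; 2; 1]) := Ordinal h.
  have {}H (a b : 'I__) : ((a < b) ==> (f a < f b)) &&
     ((s (f a) < s (f b)) == (nth 0 [:: 3; 2; 1] a < nth 0 [:: 3; 2; 1] b)).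
    exact: (forallP (H a) b).
  exists (f (o 0 isT)), (f (o 1 isT)), (f (o 2 isT)); rewrite !valn_ord ltn_ord.
  have /= /andP[-> _] := H (o 0 isT) (o 1 isT).
  have /= /andP[-> _] := H (o 1 isT) (o 2 isT).
  have /= /eqP-> := H (o 2 isT) (o 1 isT).
  by have /= /eqP-> := H (o 1 isT) (o 0 isT).
exists [ffun a : 'I_3 => inord (nth 0 [:: i; j; k] a)].
have [lj li] : j < n.+1 /\ i < n.+1 by lia.
apply/forallP => a; apply/forallP => b; rewrite !ffunE.
case: a b => [[|[|[|//]]] Ha] [[|[|[|//]]] Hb] /=; rewrite ?inordK //;
  rewrite -/(valn s i) -/(valn s j) -/(valn s k); lia.
Qed.

Lemma contains21354P n (s : 'S_n.+1) :
  reflect (exists x1 x2 x3 x4 x5,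
     [/\ [/\ x1 < x2, x2 < x3, x3 < x4, x4 < x5 & x5 < n.+1],
         valn s x2 < valn s x1, valn s x1 < valn s x3, valn s x3 < valn s x5
       & valn s x5 < valn s x4]) (contains s [:: 2; 1; 3; 5; 4]).
Proof.
apply: (iffP existsP) => [[f /forallP H]|[x1] [x2] [x3] [x4] [x5] []].
  pose o k (h : k < 5) : 'I_(size [:: 2; 1; 3; 5; 4]) := Ordinal h.
  have {}H (a b : 'I__) : ((a < b) ==> (f a < f b)) && ((s (f a) < s (f b))
      == (nth 0 [:: 2; 1; 3; 5; 4] a < nth 0 [:: 2; 1; 3; 5; 4] b)).
    exact: (forallP (H a) b).
  exists (f (o 0 isT)), (f (o 1 isT)), (f (o 2 isT)), (f (o 3 isT)), (f (o 4 isT)).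
  rewrite !valn_ord ltn_ord.
  have /= /andP[-> _] := H (o 0 isT) (o 1 isT).
  have /= /andP[-> _] := H (o 1 isT) (o 2 isT).
  have /= /andP[-> _] := H (o 2 isT) (o 3 isT).
  have /= /andP[-> _] := H (o 3 isT) (o 4 isT).
  have /= /eqP-> := H (o 1 isT) (o 0 isT).
  have /= /andP[_ /eqP->] := H (o 0 isT) (o 2 isT).
  have /= /andP[_ /eqP->] := H (o 2 isT) (o 4 isT).
  by have /= /eqP-> := H (o 4 isT) (o 3 isT).
case=> l12 l23 l34 l45 l5 v21 v13 v35 v54.
exists [ffun a : 'I_5 => inord (nth 0 [:: x1; x2; x3; x4; x5] a)].
have [l1 l2 l3 l4] : [/\ x1 < n.+1, x2 < n.+1, x3 < n.+1 & x4 < n.+1] by split; lia.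
apply/forallP => a; apply/forallP => b; rewrite !ffunE.
case: a b => [[|[|[|[|[|//]]]]] Ha] [[|[|[|[|[|//]]]]] Hb] /=; rewrite ?inordK //;
  rewrite -/(valn s x1) -/(valn s x2) -/(valn s x3) -/(valn s x4) -/(valn s x5);
  lia.
Qed.

Lemma fishburnP n (s : 'S_n.+1) :
  reflect (nat_fishburn n.+1 (valn s)) (fishburn s).
Proof.
have [_ inj _] := natperm_valn s.
apply: (iffP negP) => [H i k ik kn e | H].
  rewrite ltnNge; apply/negP => le.
  have neq : valn s i <> valn s i.+1 by move=> /inj; lia.
  apply: H; apply/existsP; exists (inord i); apply/existsP; exists (inord k).
  apply/existsP; exists (inord i.+1).
  rewrite /= -/(valn s i) -/(valn s k) -/(valn s i.+1) !inordK; lia.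
case/existsP=> i /existsP[k] /existsP[i1] /and5P[ik /eqP e1 _ lt /eqP e].
have := H i k ik (ltn_ord k); rewrite -e1 !valn_ord => /(_ e).
by rewrite ltnNge ltnW.
Qed.

Lemma in_FP n (s : 'S_n.+1) : reflect (in_F n.+1 (valn s)) (s \in F_321_21354 n.+1).
Proof.
rewrite inE /avoids.
apply: (iffP and3P) => [[/fishburnP h1 h2 h3]|[h1 h2 h3]]; split=> //.
- move=> i j k ij jk kn v1 v2; case/contains321P: h2; by exists i, j, k.
- move=> x1 x2 x3 x4 x5 *; case/contains21354P: h3.
  by exists x1, x2, x3, x4, x5.
- exact/fishburnP.
- by apply/contains321P => -[i] [j] [k] [ij jk kn v1 v2]; apply: (h2 i j k).
apply/contains21354P => -[x1] [x2] [x3] [x4] [x5] [[? ? ? ? ?] ? ? ? ?].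
exact: (h3 x1 x2 x3 x4 x5).
Qed.

(** * Removing a leading minimum or a trailing maximum *)

(** A leading minimum could only be the first letter of a forbidden configuration, and in each of
    them the first letter exceeds a later one. *)
Lemma in_F_shift n (p q : nat -> nat) :
  q 0 = 0 -> (forall i, i < n -> q i.+1 = (p i).+1) ->
  in_F n.+1 q <-> in_F n p.
Proof.
move=> q0 qS; split=> -[fi h3 h5]; split.
- move=> i k ik kn e; have := fi i.+1 k.+1 ik kn.
  rewrite !qS; [|lia..]. by rewrite e => /(_ erefl).
- move=> i j k ij jk kn; have := h3 i.+1 j.+1 k.+1 ij jk kn.
  by rewrite !qS //; lia.
- move=> x1 x2 x3 x4 x5 l12 l23 l34 l45 l5.
  have := h5 x1.+1 x2.+1 x3.+1 x4.+1 x5.+1 l12 l23 l34 l45 l5.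
  by rewrite !qS //; lia.
- move=> [|i] [|k] //; first by rewrite q0.
  move=> ik kn; rewrite !qS; [|lia..].
  by move=> [e]; rewrite ltnS; apply: (fi i k).
- move=> i [|j] [|k] // ij jk kn.
  case: i ij => [|i] ij; first by rewrite q0.
  rewrite !qS; [|lia..]; exact: h3.
- move=> x1 [|x2] [|x3] [|x4] [|x5] // l12 l23 l34 l45 l5.
  case: x1 l12 => [|x1] l12; first by rewrite q0.
  rewrite !qS; [|lia..]; exact: h5.
Qed.

(** A trailing maximum could only be the last letter, which in each forbidden configuration lies
    below an earlier one. *)
Lemma in_F_rcons n (p q : nat -> nat) :
  q n = n -> (forall i, i < n -> p i < n) -> (forall i, i < n -> q i = p i) ->
  in_F n.+1 q <-> in_F n p.
Proof.
move=> qn pn qE; split=> -[fi h3 h5]; split.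
- by move=> i k ik kn; rewrite -!qE; [apply: fi => //; lia | lia..].
- by move=> i j k ij jk kn; rewrite -!qE; [apply: h3 => //; lia | lia..].
- move=> x1 x2 x3 x4 x5 *.
  by apply: (h5 x1 x2 x3 x4 x5); rewrite ?qE //; lia.
- move=> i k ik; rewrite ltnS leq_eqVlt => /predU1P[e|kn].
    rewrite e in ik *; rewrite qn; case: (ltnP i n) => [li|]; last by lia.
    rewrite qE //; have := pn i li; lia.
  rewrite !qE; [|lia..]; exact: fi.
- move=> i j k ij jk; rewrite ltnS leq_eqVlt => /predU1P[e|kn].
    rewrite e in jk *; case: (ltnP j n) => [lj|]; last by lia.
    rewrite qn qE //; have := pn j lj; lia.
  rewrite !qE; [|lia..]; exact: h3.
- move=> x1 x2 x3 x4 x5 l12 l23 l34 l45.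
  rewrite ltnS leq_eqVlt => /predU1P[e|ln].
    rewrite e in l45 *; case: (ltnP x4 n) => [lj|]; last by lia.
    rewrite qn (qE x4) //; have := pn x4 lj; lia.
  rewrite !qE; [|lia..]; exact: h5.
Qed.

Lemma card_code (T : finType) (C : eqType) (A : {set T}) (e : T -> C) (l : seq C) :
  uniq l -> {in A &, injective e} -> (forall x, x \in A -> e x \in l) ->
  (forall c, c \in l -> exists2 x, x \in A & e x = c) -> #|A| = size l.
Proof.
move=> ul inj eA eS; rewrite cardE -(size_map e); apply/perm_size/uniq_perm => //.
  by rewrite map_inj_in_uniq ?enum_uniq // => x y; rewrite !mem_enum; apply: inj.
move=> c; apply/mapP/idP => [[x]|/eS[x xA <-]]; last by exists x; rewrite ?mem_enum.
by rewrite mem_enum => /eA ? ->.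
Qed.

Lemma valn_lift_first n (s : 'S_n.+1) :
  valn (lift_perm ord0 ord0 s) 0 = 0 /\
  forall i, i < n.+1 -> valn (lift_perm ord0 ord0 s) i.+1 = (valn s i).+1.
Proof.
split=> [|i lin].
  by rewrite /valn (_ : inord 0 = ord0) ?lift_perm_id //; apply/val_inj; rewrite /= inordK.
rewrite /valn (_ : inord i.+1 = lift ord0 (inord i)) ?lift_perm_lift ?lift0 //.
by apply/val_inj; rewrite /= /bump /= !inordK.
Qed.

Lemma valn_lift_last n (s : 'S_n.+1) :
  valn (lift_perm ord_max ord_max s) n.+1 = n.+1 /\
  forall i, i < n.+1 -> valn (lift_perm ord_max ord_max s) i = valn s i.
Proof.
split=> [|i lin].
  by rewrite /valn (_ : inord n.+1 = ord_max) ?lift_perm_id //; apply/val_inj; rewrite /= inordK.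
rewrite /valn (_ : inord i = lift ord_max (inord i)) ?lift_perm_lift ?lift_max //.
by apply/val_inj; rewrite /= /bump !inordK //; lia.
Qed.

(** The extra condition [P] lets the same bijection also count the members that have a trailing
    maximum besides. *)
Lemma card_fixed_first n (P : pred 'S_n.+2) :
  #|[set s in F_321_21354 n.+2 | (valn s 0 == 0) && P s]|
    = #|[set s in F_321_21354 n.+1 | P (lift_perm ord0 ord0 s)]|.
Proof.
symmetry; rewrite [RHS]cardE.
apply: (@card_code _ _ _ (lift_perm ord0 ord0)); first exact: enum_uniq.
- move=> s t _ _ e; apply: valn_inj => i lin; apply: succn_inj.
  have [_ <- //] := valn_lift_first s; have [_ <- //] := valn_lift_first t.
  by rewrite e.
- move=> s /setIdP[/in_FP Fs Ps]; rewrite mem_enum inE Ps.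
  have [e0 eS] := valn_lift_first s; rewrite e0 eqxx !andbT.
  by apply/in_FP/(in_F_shift e0 eS).
move=> t; rewrite mem_enum inE => /and3P[/in_FP Ft /eqP t0 Pt].
have [bnd inj _] := natperm_valn t.
have pos i : i < n.+1 -> 0 < valn t i.+1.
  by move=> lin; rewrite lt0n; apply/eqP => e; have := inj i.+1 0; lia.
have [i lin|i k ik kn|s sE] := @perm_of_nat n (fun i => (valn t i.+1).-1).
- have := bnd i.+1; lia.
- have := pos i; have := pos k; have := inj i.+1 k.+1; lia.
have [e0 eS] := valn_lift_first s.
have st : lift_perm ord0 ord0 s = t.
  apply: valn_inj => -[|i] lin; first by rewrite e0 t0.
  by rewrite eS // sE // prednK // pos.
exists s => //; rewrite inE st Pt andbT; apply/in_FP/(in_F_shift e0 eS).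
by rewrite st.
Qed.

Lemma card_fixed_last n :
  #|[set s in F_321_21354 n.+2 | valn s n.+1 == n.+1]| = #|F_321_21354 n.+1|.
Proof.
symmetry; rewrite [RHS]cardE.
apply: (@card_code _ _ _ (lift_perm ord_max ord_max)); first exact: enum_uniq.
- move=> s t _ _ e; apply: valn_inj => i lin.
  have [_ <- //] := valn_lift_last s; have [_ <- //] := valn_lift_last t.
  by rewrite e.
- move=> s /in_FP Fs; rewrite mem_enum inE.
  have [e0 eS] := valn_lift_last s; rewrite e0 eqxx andbT.
  have [bnd _ _] := natperm_valn s.
  by apply/in_FP/(in_F_rcons e0 bnd eS).
move=> t; rewrite mem_enum inE => /andP[/in_FP Ft /eqP t0].
have [bnd inj _] := natperm_valn t.
have lt i : i < n.+1 -> valn t i < n.+1.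
  move=> lin; have := bnd i; have := inj i n.+1; lia.
have [//|i k ik kn e|s sE] := @perm_of_nat n (valn t).
  by have := inj i k; lia.
have [e0 eS] := valn_lift_last s.
have st : lift_perm ord_max ord_max s = t.
  apply: valn_inj => i; rewrite ltnS leq_eqVlt => /predU1P[->|lin].
    by rewrite e0 t0.
  by rewrite eS // sE.
have [bs _ _] := natperm_valn s.
exists s => //; apply/in_FP/(in_F_rcons e0 bs eS).
by rewrite st.
Qed.

(** * The recurrence by inclusion and exclusion *)

Definition H_321_21354 n : {set 'S_n.+1} :=
  [set s in F_321_21354 n.+1 | (valn s 0 != 0) && (valn s n != n)].

Lemma card_F_rec n :
  #|F_321_21354 n.+3| + #|F_321_21354 n.+1|
    = (#|F_321_21354 n.+2|).*2 + #|H_321_21354 n.+2|.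
Proof.
set A := F_321_21354 n.+3.
pose A1 := [set s in A | valn s 0 == 0].
pose A2 := [set s in A | valn s n.+2 == n.+2].
have c1 : #|A1| = #|F_321_21354 n.+2|.
  have := card_fixed_first (fun _ : 'S_n.+3 => true).
  rewrite [X in _ = #|pred_of_set X|](_ : _ = F_321_21354 n.+2); last first.
    by apply/setP => s; rewrite [LHS]inE andbT.
  by move=> <-; apply/eq_card => s; rewrite [LHS]inE [RHS]inE andbT.
have c2 : #|A2| = #|F_321_21354 n.+2| by apply: card_fixed_last.
(* For members with both features, remove the leading minimum, then the trailing maximum. *)
have c12 : #|A1 :&: A2| = #|F_321_21354 n.+1|.
  rewrite -card_fixed_last.
  have := card_fixed_first (fun s : 'S_n.+3 => valn s n.+2 == n.+2).
  rewrite [X in _ = #|pred_of_set X|](_ : _ = [set s in F_321_21354 n.+2 | valn s n.+1 == n.+1]).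
    move=> <-; apply/eq_card => s.
    rewrite in_setI [s \in A1]inE [s \in A2]inE [RHS]inE -/A.
    by case: (s \in A); case: (_ == 0).
  apply/setP => s; rewrite [LHS]inE [RHS]inE; congr (_ && _).
  by have [_ ->] := valn_lift_first s.
have := cardsUI A1 A2; rewrite c12 c1 c2.
have -> : H_321_21354 n.+2 = A :\: (A1 :|: A2).
  apply/setP => s; rewrite !in_setD !in_setU [s \in A1]inE [s \in A2]inE [LHS]inE -/A.
  by case: (s \in A); case: (_ == 0); case: (_ == n.+2).
have : A1 :|: A2 \subset A.
  by apply/subsetP => s; rewrite in_setU [s \in A1]inE [s \in A2]inE => /orP[] /andP[].
move=> sub; rewrite cardsDS //; have := subset_leq_card sub; lia.
Qed.

(** * Binary words and the number of codes *)

Fixpoint bitwords (n : nat) : seq (seq bool) :=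
  if n is n'.+1 then map (cons true) (bitwords n') ++ map (cons false) (bitwords n')
  else [:: [::]].

Lemma mem_bitwords n w : (w \in bitwords n) = (size w == n).
Proof.
elim: n w => [|n IH] w /=; first by rewrite inE size_eq0.
rewrite mem_cat; apply/orP/eqP => [[] /mapP[v]|].
- by rewrite IH => /eqP sv ->; rewrite /= sv.
- by rewrite IH => /eqP sv ->; rewrite /= sv.
case: w => [//|[] w] /= [sw]; [left|right]; apply/mapP; exists w => //;
  by rewrite IH sw.
Qed.

Lemma uniq_bitwords n : uniq (bitwords n).
Proof.
elim: n => //= n IH; rewrite cat_uniq !map_inj_uniq ?IH; try by move=> ? ? [].
by rewrite /= andbT; apply/hasPn => w /mapP[v _ ->]; apply/mapP => -[].
Qed.

Lemma size_bitwords n : size (bitwords n) = 2 ^ n.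
Proof. by elim: n => //= n IH; rewrite size_cat !size_map IH expnS mul2n addnn. Qed.

(** The condition on D for j > 0: there is a least place after 0, and its successor is outside D.
    The end of the word counts as false. *)
Fixpoint isolated_first (w : seq bool) : bool :=
  match w with
  | [::] => false
  | true :: w' => ~~ head false w'
  | false :: w' => isolated_first w'
  end.

Lemma isolated_firstP w :
  reflect (exists i, [/\ nth false w i, forall k, k < i -> ~~ nth false w k
                       & ~~ nth false w i.+1]) (isolated_first w).
Proof.
elim: w => [|[] w IH] /=.
- by apply: ReflectF => -[i] []; rewrite nth_nil.
- apply: (iffP idP) => [h|[[|i] [_ h1 h2]]].
  + by exists 0; split=> //=; rewrite nth0.
  + by move: h2 => /=; rewrite nth0.
  + by have := h1 0 isT.
apply: (iffP IH) => [[i [h1 h2 h3]]|[[|i] [//= h1 h2 h3]]].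
  by exists i.+1; split=> // -[|k] //; apply: h2.
by exists i; split=> // k ki; apply: (h2 k.+1).
Qed.

(** A word starting with true needs false next and is free afterwards; one starting with false
    defers to its tail. In length [n.+2] each kind contributes [2 ^ n]. *)
Lemma count_isolated_first n : count isolated_first (bitwords n.+1) = 2 ^ n.
Proof.
elim: n => [//|n IH]; rewrite [bitwords _.+2]/= count_cat !count_map.
have -> : count (preim (cons true) isolated_first) (bitwords n.+1) = 2 ^ n.
  rewrite /= count_cat !count_map (eq_count (a2 := pred0)) // count_pred0.
  by rewrite (eq_count (a2 := predT)) // count_predT size_bitwords.
rewrite (eq_count (a2 := isolated_first)) // IH expnS; lia.
Qed.

(** Here the permutations have length [n.+3]: the word records D at the places 2 to n + 1 if j = 0,
    and 2 to n + 2 - j otherwise. *)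
Definition code_words (n j : nat) : seq (seq bool) :=
  if j == 0 then bitwords n else filter isolated_first (bitwords (n.+1 - j)).

Definition codes (n : nat) : seq (nat * seq bool) :=
  [seq (j, w) | j <- iota 0 n.+1, w <- code_words n j].

Lemma uniq_codes n : uniq (codes n).
Proof.
apply: allpairs_uniq_dep; first exact: iota_uniq.
  by move=> j _; rewrite /code_words; case: eqP => _; rewrite ?filter_uniq ?uniq_bitwords.
by move=> [j1 w1] [j2 w2] _ _ /= [-> ->].
Qed.

Lemma mem_codes n (j : nat) (w : seq bool) :
  ((j, w) \in codes n) =
  [&& j <= n, size w == n.+1 - maxn j 1 & (j == 0) || isolated_first w].
Proof.
have mw : (w \in code_words n j) =
    (size w == n.+1 - maxn j 1) && ((j == 0) || isolated_first w).
  rewrite /code_words; case: j => [|j] /=.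
    by rewrite mem_bitwords max0n subSS subn0 andbT.
  by rewrite mem_filter mem_bitwords andbC (_ : maxn j.+1 1 = j.+1) //; lia.
apply/allpairsPdep/andP => [[j' [w' [hj hw [e1 e2]]]]|[hj hw]].
  by move: hj hw; rewrite -e1 -e2 mw mem_iota => hj ->; split=> //; lia.
by exists j, w; split=> //; rewrite ?mw // mem_iota; lia.
Qed.

Lemma size_codes n : (size (codes n)).+1 = 2 ^ n.+1.
Proof.
rewrite size_allpairs_dep /= {1}/code_words /= size_bitwords.
(* Each [j > 0] contributes [2 ^ (n - j)] words, so the last [m] values of [j] give the geometric
   sum [2 ^ m - 1]. *)
have step m : m <= n ->
    (sumn [seq size (code_words n j) | j <- iota (n - m).+1 m]).+1 = 2 ^ m.
  elim: m => [//|m IH] mn /=.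
  have -> : (n - m.+1).+2 = (n - m).+1 by lia.
  rewrite -addnS IH; last by lia.
  rewrite /code_words /= size_filter (_ : n.+1 - (n - m.+1).+1 = m.+1); last by lia.
  by rewrite count_isolated_first expnS mul2n addnn.
by have := step n (leqnn n); rewrite subnn -addnS => ->; rewrite expnS mul2n addnn.
Qed.

(** * Left-to-right maxima and reconstruction from j and D *)

Definition lrmax (p : nat -> nat) (i : nat) : bool :=
  all (fun k => p k < p i) (iota 0 i).

Lemma lrmaxP p i : reflect (forall k, k < i -> p k < p i) (lrmax p i).
Proof.
apply: (iffP allP) => h k; first by move=> ki; apply: h; rewrite mem_iota.
by rewrite mem_iota /= add0n; apply: h.
Qed.

Definition two_step (n j : nat) (D : pred nat) (p : nat -> nat) : Prop :=
  [/\ natperm n p,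
      D 0 /\ p 0 + j < n,
      forall i, i < n -> D i = (i == 0) || (p 0 + j < p i),
      forall i k, i < k -> k < n -> D i -> D k -> p i < p k
    & forall i k, i < k -> k < n -> ~~ D i -> ~~ D k -> p i < p k].

(** Let [p] take the value [q i] at [k]. This value exceeds [p 0 + j], so [k] is in [D]; then
    [k < i] contradicts monotonicity on [D], and [k > i] gives [q k = q i]. *)
Lemma two_step_upper n j D p q i :
  two_step n j D p -> natperm n q -> 0 < i -> i < n -> D i ->
  (forall k, i < k -> k < n -> D k -> p k = q k) -> p i < q i -> False.
Proof.
move=> [[bp ip sp] [D0 _] Dp inc _] [bq iq _] i0 lin Di agree lt.
have [k lkn ek] := sp _ (bq i lin).
have gt : p 0 + j < p i by have := Dp i lin; rewrite Di; lia.
have k0 : k <> 0 by move=> e; move: ek; rewrite e; lia.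
have Dk : D k by rewrite Dp //; lia.
case: (ltngtP k i) => [ki|ik|e].
- have := inc k i ki lin Dk Di; lia.
- have := agree k ik lkn Dk; rewrite ek => /(iq i k lin lkn); lia.
- by move: ek; rewrite e; lia.
Qed.

(** The mirror argument: [q] takes the value [p i] at some [k] off [D], and neither side of [i] is
    possible for [k]. *)
Lemma two_step_lower n j D p q i :
  two_step n j D p -> two_step n j D q -> p 0 = q 0 -> i < n -> ~~ D i ->
  (forall k, k < i -> ~~ D k -> p k = q k) -> p i < q i -> False.
Proof.
move=> [[bp ip sp] [D0 _] Dp _ _] [[bq iq sq] _ Dq _ inc] e0 lin Di agree lt.
have [k lkn ek] := sq _ (bp i lin).
have i0 : i <> 0 by move=> e; move: Di; rewrite e D0.
have le : p i <= p 0 + j by move: Di; rewrite Dp //; lia.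
have k0 : k <> 0.
  move=> e; apply: i0; apply: ip => //; first lia.
  by rewrite e0 -ek e.
have Dk : ~~ D k by rewrite Dq //; lia.
case: (ltngtP k i) => [ki|ik|e].
- have := agree k ki Dk; rewrite ek => /(ip k i lkn lin); lia.
- have := inc i k ik lkn Di Dk; lia.
- by move: ek; rewrite e; lia.
Qed.

(** The values on [D] after place 0 are determined from right to left, then [p 0], then the values
    off [D] from left to right. *)
Lemma two_step_uniq n j D p q :
  two_step n j D p -> two_step n j D q -> forall i, i < n -> p i = q i.
Proof.
move=> tp tq.
have [npp [D0 ltp] Dp _ _] := tp; have [npq [_ ltq] Dq _ _] := tq.
have upper d i : n - i <= d -> 0 < i -> i < n -> D i -> p i = q i.
  elim: d i => [|d IH] i; first by lia.
  move=> le i0 lin Di.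
  have agree k : i < k -> k < n -> D k -> p k = q k by move=> *; apply: IH; lia.
  case: (ltngtP (p i) (q i)) => // lt.
    by case: (two_step_upper tp npq i0 lin Di agree lt).
  by case: (two_step_upper tq npp i0 lin Di _ lt) => k *; rewrite agree.
have [bp ip sp] := npp; have [bq iq sq] := npq.
move=> i lin; have n0 : 0 < n by lia.
have e0 : p 0 = q 0.
  case: (ltngtP (p 0) (q 0)) => // lt.
    (* In [p] this value sits at a place of [D], where [q] agrees with [p] but would have to exceed
       [q 0 + j]. *)
    have [|k lkn ek] := sp (p 0 + j).+1; first by lia.
    have k0 : 0 < k by case: k {lkn} ek => //; lia.
    have Dk : D k by rewrite Dp //; lia.
    have := Dq k lkn; have := upper n k; rewrite Dk; lia.
  have [|k lkn ek] := sq (q 0 + j).+1; first by lia.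
  have k0 : 0 < k by case: k {lkn} ek => //; lia.
  have Dk : D k by rewrite Dq //; lia.
  have := Dp k lkn; have := upper n k; rewrite Dk; lia.
have lower d k : k < d -> k < n -> ~~ D k -> p k = q k.
  elim: d k => [|d IH] k; first by lia.
  move=> le lkn Dk.
  have agree l : l < k -> ~~ D l -> p l = q l by move=> *; apply: IH; lia.
  case: (ltngtP (p k) (q k)) => // lt.
    by case: (two_step_lower tp tq e0 lkn Dk agree lt).
  by case: (two_step_lower tq tp (esym e0) lkn Dk _ lt) => l *; rewrite agree.
case: (posnP i) => [->//|i0].
case: (boolP (D i)) => Di; first by apply: (upper n) => //; lia.
by apply: (lower i.+1).
Qed.

(** * Structure of members with neither leading minimum nor trailing maximum *)

Definition in_H (n : nat) (p : nat -> nat) : Prop :=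
  [/\ natperm n p, in_F n p, p 0 <> 0 & p n.-1 <> n.-1].

Definition excess (n : nat) (p : nat -> nat) : nat := p n.-1 - p 0.

(* The value p 0 - 1 lies to the right of p 0, so place 0 is a descent, and the
   values below p 0 appear in increasing order. *)
Lemma in_H_second n p : 2 < n -> in_H n p -> p 1 = 0.
Proof.
move=> n2 [[bp ip sp] [fi h3 _] p0 _].
have b0 := bp 0.
have [|k lkn ek] := sp (p 0).-1; first by lia.
have k0 : k <> 0 by move=> e; move: ek; rewrite e; lia.
have lt : p 1 < p 0 by apply: (fi 0 k); lia.
have [|l lln el] := sp 0; first by lia.
case: (posnP (p 1)) => // p1.
have l1 : 1 < l by case: l {lln} el => [|[|l]] //; lia.
by case: (h3 0 1 l); lia.
Qed.

Lemma in_H_max_pos n p : 2 < n -> in_H n p ->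
  exists2 k, k < n.-1 & p k = n.-1.
Proof.
move=> n2 [[bp ip sp] _ _ pl]; have [|k lkn ek] := sp n.-1; first by lia.
have kl : k <> n.-1 by move=> e; apply: pl; rewrite -{1}e.
by exists k => //; lia.
Qed.

(** A later left-to-right maximum not above the bound would be the 3 of a 21354 formed with the
    places 0 and 1, the maximum and the last place. Conversely, a value above the bound that has a
    larger one before it gives a 321 ending at the last place. *)
Lemma in_H_lrmax n p i : 2 < n -> in_H n p -> i < n ->
  lrmax p i = (i == 0) || (p 0 + excess n p < p i).
Proof.
move=> n2 hH lin; have p1 := in_H_second n2 hH.
have [P lP eP] := in_H_max_pos n2 hH.
have [[bp ip sp] [fi h3 h5] p0 pl] := hH; rewrite /excess.
case: (posnP i) => [->//|i0] /=.
have bi := bp i lin; have bl : p n.-1 < n by apply: bp; lia.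
have nl : p n.-1 <> p 0 by move=> /ip; lia.
apply/lrmaxP/idP => [lr|gt k ki].
  have gt0 := lr 0 i0; rewrite ltnNge; apply/negP => le.
  have lt1 : p 1 < p 0 by lia.
  have i1 : i <> 1 by move=> e; move: gt0; rewrite e; lia.
  have il : i <> n.-1 by move=> e; have := lr P; rewrite e eP; lia.
  have nil : p i <> p n.-1 by move=> /ip; lia.
  have iP : i <> P by move=> e; move: le; rewrite e eP; lia.
  case: (ltnP i P) => [lt|le']; last by have := lr P; rewrite eP; lia.
  by case: (h5 0 1 i P n.-1); lia.
have nki : p k <> p i by move=> /ip; lia.
rewrite ltnNge; apply/negP => le.
have il : i <> n.-1 by move=> e; move: gt; rewrite e; lia.
by case: (h3 k i n.-1); lia.
Qed.

Lemma in_H_two_step n p : 2 < n -> in_H n p ->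
  two_step n (excess n p) (lrmax p) p.
Proof.
move=> n2 hH; have [np [_ h3 _] p0 pl] := hH; have [bp ip sp] := np.
split=> //.
- split=> //; have := bp 0; have := bp n.-1; rewrite /excess; lia.
- by move=> i lin; apply: in_H_lrmax.
- by move=> i k ik lkn _ /lrmaxP; apply.
move=> i k ik lkn nDi _; rewrite ltnNge; apply/negP => le.
have nik : p i <> p k by move=> /ip; lia.
case/negP: nDi; apply/lrmaxP => l li; rewrite ltnNge; apply/negP => le'.
have nli : p l <> p i by move=> /ip; lia.
by case: (h3 l i k); lia.
Qed.

(** Going leftwards, let the next value down sit at [y], left of its expected place [z]. If [z] is
    in D, the places 0, 1, [y], [z] and the last one form 21354; if not, monotonicity off D puts
    [p z] strictly between two consecutive values. *)
Lemma in_H_tail_value n p i : 2 < n -> in_H n p -> i < excess n p ->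
  i < n /\ p (n.-1 - i) = p n.-1 - i.
Proof.
move=> n2 hH; have p1 := in_H_second n2 hH.
have [[bp ip sp] [D0 ltn_b] Dp _ inc] := in_H_two_step n2 hH.
have [_ [_ _ h5] p0 pl] := hH.
have bE : 0 < excess n p -> p 0 + excess n p = p n.-1 by rewrite /excess; lia.
elim: i => [|i IH] lt; first by rewrite !subn0; split=> //; lia.
have [|lin pi] := IH; first by lia.
have [|y lyn ey] := sp (p n.-1 - i.+1); first by lia.
have y0 : y <> 0 by move=> e; move: ey; rewrite e; lia.
have y1 : y <> 1 by move=> e; move: ey; rewrite e; lia.
have Dy : ~~ lrmax p y by rewrite Dp // ey; lia.
have nz : n.-1 - i <> 0 by move=> e; move: pi; rewrite e; lia.
have Di : ~~ lrmax p (n.-1 - i) by rewrite Dp ?pi; lia.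
have lty : y < n.-1 - i.
  case: (ltngtP y (n.-1 - i)) => // h; last by move: ey; rewrite h pi; lia.
  have := inc _ _ h lyn Di Dy; lia.
split; first by lia.
case: (ltngtP y (n.-1 - i.+1)) => [h||<-] //; last by lia.
set z := n.-1 - i.+1 in h *.
have lz : z < n by lia.
have Dz : ~~ lrmax p z.
  rewrite Dp //; apply/negP => /orP[/eqP|gt]; first by lia.
  by case: (h5 0 1 y z n.-1); lia.
have := inc _ _ h lz Dy Dz.
have := inc z (n.-1 - i) _ _ Dz Di; lia.
Qed.

(** This allows the word of a code to stop before these places. When the excess is 0, only the last
    place is concerned, and its value is at most [p 0]. *)
Lemma in_H_tail n p i : 2 < n -> in_H n p -> i < n ->
  n - maxn (excess n p) 1 <= i -> ~~ lrmax p i.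
Proof.
move=> n2 hH lin le; have [_ [_ _] Dp _ _] := in_H_two_step n2 hH.
rewrite Dp //.
have [e|lt] := posnP (excess n p).
  have -> : i = n.-1 by lia.
  by move: e; rewrite /excess; lia.
have [|_] := @in_H_tail_value n p (n.-1 - i) n2 hH; first by lia.
have -> : n.-1 - (n.-1 - i) = i by lia.
have [_ _ p0 _] := hH; have := in_H_second n2 hH.
by rewrite /excess in le lt *; case: i lin le => [|i]; lia.
Qed.

(** * Encoding *)

(** Only undecided places are recorded: place 0 is always in D, while place 1 and the last
    [maxn (excess n p) 1] places never are. *)
Definition encode (n : nat) (p : nat -> nat) : nat * seq bool :=
  (excess n p, mkseq (fun i => lrmax p i.+2) (n - 2 - maxn (excess n p) 1)).

Lemma encode_lrmax n p i : 2 < n -> in_H n p -> i < n ->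
  lrmax p i = (i == 0) || (1 < i) && nth false (encode n p).2 (i - 2).
Proof.
move=> n2 hH lin /=; have p1 := in_H_second n2 hH; have [_ _ p0 _] := hH.
case: i lin => [//|[|i]] lin.
  by rewrite /= /lrmax /= p1; lia.
rewrite /= subSS subSS subn0.
case: (ltnP i (n - 2 - maxn (excess n p) 1)) => le; first by rewrite nth_mkseq.
rewrite nth_default ?size_mkseq //; apply/negbTE/(in_H_tail n2) => //; lia.
Qed.

Lemma encode_inj n p q : 2 < n -> in_H n p -> in_H n q ->
  encode n p = encode n q -> forall i, i < n -> p i = q i.
Proof.
move=> n2 hp hq e.
have ej : excess n p = excess n q by case: e.
have eD i : i < n -> lrmax q i = lrmax p i.
  by move=> lin; rewrite (encode_lrmax n2 hp) // (encode_lrmax n2 hq) // e.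
have tp := in_H_two_step n2 hp.
have [npq [D0 lt] Dq inc inc'] := in_H_two_step n2 hq.
apply: (two_step_uniq tp); rewrite ej; split=> //.
- by move=> i lin; rewrite -eD // Dq.
- by move=> i k ik lkn; rewrite -!eD //; [apply: inc | lia].
- by move=> i k ik lkn; rewrite -!eD //; [apply: inc' | lia].
Qed.

Lemma encode_mem n p : in_H n.+3 p -> encode n.+3 p \in codes n.
Proof.
move=> hH; have n2 : 2 < n.+3 by [].
have p1 := in_H_second n2 hH.
have [[bp ip sp] [D0 ltb] Dp inc _] := in_H_two_step n2 hH.
have [_ [fi _ _] p0 pl] := hH.
rewrite mem_codes size_mkseq.
set j := excess _ _ in ltb Dp *.
have [j0|jpos] := posnP j; first by rewrite j0; apply/and3P; split=> //; lia.
have bl : p 0 + j = p n.+2.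
  by move: jpos; rewrite /j /excess /=; lia.
have bn := bp n.+2; rewrite /= in pl.
(* The place [i] of the value b + 1 is the least one of D after 0, since [p] increases on D and its
   values there exceed b. *)
have [|i lin ei] := sp (p n.+2).+1; first by lia.
have i0 : i <> 0 by move=> e; move: ei; rewrite e; lia.
have i1 : i <> 1 by move=> e; move: ei; rewrite e; lia.
have il : i <> n.+2 by move=> e; move: ei; rewrite e; lia.
have Di : lrmax p i by rewrite Dp //; lia.
have ti : i < n.+3 - j.
  rewrite ltnNge; apply/negP => le; have := @in_H_tail n.+3 p i n2 hH lin.
  rewrite -/j Di; lia.
(* The value b stands at the last place, so the Fishburn condition makes [i] a descent, and [i.+1]
   is outside D. *)
have desc : p i.+1 < p i by apply: (fi i n.+2); lia.
have nth_w k : nth false (encode n.+3 p).2 k = (k.+2 < n.+3) && lrmax p k.+2.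
  case: (ltnP k.+2 n.+3) => lk.
    by rewrite (encode_lrmax n2 hH lk) 2!subSS subn0.
  by rewrite nth_default // size_mkseq; lia.
apply/and3P; split; [lia|lia|].
apply/orP; right; apply/isolated_firstP; exists (i - 2); split.
- by rewrite nth_w (_ : (i - 2).+2 = i) ?Di ?andbT; lia.
- move=> k lk; rewrite nth_w; apply/negP => /andP[lk' Dk].
  have := inc k.+2 i _ _ Dk Di; have := Dp k.+2 lk'; rewrite Dk; lia.
rewrite nth_w (_ : (i - 2).+3 = i.+1); last by lia.
by apply/negP => /andP[_ /lrmaxP/(_ i (ltnSn i))]; lia.
Qed.

(** * Decoding *)

(* The word w lists membership in D from place 2 on; place 1 never lies in D. *)
Definition code_set (w : seq bool) (i : nat) : bool :=
  (i == 0) || (1 < i) && nth false w (i - 2).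

(** This counts the places of D in 2, ..., i - 1. *)
Definition rank (w : seq bool) (i : nat) : nat := count id (take (i - 2) w).

(* Here n is the length and [count id w] the number of places of D other than 0,
   so that b = n - 1 - count id w. *)
Definition decode (n j : nat) (w : seq bool) (i : nat) : nat :=
  if i == 0 then n.-1 - count id w - j
  else if code_set w i then n - count id w + rank w i
  else i - rank w i - (i < n - j).

Lemma rankS w i : 1 < i -> rank w i.+1 = rank w i + code_set w i.
Proof.
move=> i1; rewrite /rank /code_set subSn //.
have -> : i == 0 = false by lia.
rewrite i1 /=; case: (ltnP (i - 2) (size w)) => h.
  by rewrite (take_nth false) // -cats1 count_cat /= addn0.
by rewrite !take_oversize ?nth_default ?addn0 //; lia.
Qed.

Lemma rank_le w i k : 1 < i -> i <= k -> rank w i <= rank w k <= rank w i + (k - i).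
Proof.
move=> i1; elim: k => [|k IH]; first by lia.
rewrite leq_eqVlt => /predU1P[<-|ik]; first by lia.
rewrite rankS; [|lia]; have := IH ik; case: code_set; lia.
Qed.

Lemma rank_lt w i k : 1 < i -> i < k -> code_set w i -> rank w i < rank w k.
Proof.
move=> i1 ik Di; have := @rank_le w i.+1 k; rewrite rankS // Di; lia.
Qed.

(** In subtraction-free form, [i - rank w i] strictly grows after a place off D; hence the decoded
    function increases off D. *)
Lemma rank_gap w i k : 0 < i -> i < k -> ~~ code_set w i ->
  rank w k + i < rank w i + k.
Proof.
move=> i0 ik Di; case: (ltnP 1 i) => i1.
  have := @rank_le w i.+1 k; rewrite rankS // (negbTE Di); lia.
have -> : i = 1 by lia.
have := @rank_le w 2 k; rewrite /rank take0 /=; lia.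
Qed.

Lemma rank_count w i : size w + 2 <= i -> rank w i = count id w.
Proof. by move=> h; rewrite /rank take_oversize //; lia. Qed.

Lemma code_set_lt w i : 0 < i -> code_set w i -> 1 < i < size w + 2.
Proof.
rewrite /code_set => i0; have -> : i == 0 = false by lia.
case/andP=> i1; case: (ltnP (i - 2) (size w)) => h; first by lia.
by rewrite nth_default.
Qed.

(* Off D the values exceeding a sit at the last j places; in particular a itself
   is taken only at 0. *)
Definition shaped (n j a : nat) (D : pred nat) (p : nat -> nat) : Prop :=
  [/\ [/\ p 0 = a, 0 < a, a + j < n & p 1 = 0],
      (forall i, i < n -> D i = (i == 0) || (a + j < p i)),
      (forall i k, i < k -> k < n -> D i -> D k -> p i < p k),
      (forall i k, i < k -> k < n -> ~~ D i -> ~~ D k -> p i < p k)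
    & (forall i, i < n -> ~~ D i -> p i < a \/ a < p i /\ n - j <= i)].

(** Off D, [i - rank w i - 1] counts the earlier places off D; in the last [j] places the 1 is no
    longer subtracted, which skips the value a. On D after place 0, the values run upwards from b +
    1. *)
Lemma decode_shaped n (j : nat) (w : seq bool) : (j, w) \in codes n ->
  let p := decode n.+3 j w in
  shaped n.+3 j (n.+2 - count id w - j) (code_set w) p /\
  forall i, i < n.+3 -> p i < n.+3.
Proof.
rewrite mem_codes => /and3P[jn /eqP sw _] p.
have cw : count id w <= size w by apply: count_size.
set r := count id w in cw *; set a := n.+2 - r - j.
have p0 : p 0 = a by [].
have pD i : 0 < i -> code_set w i -> p i = n.+3 - r + rank w i.
  by move=> i0 Di; rewrite /p /decode Di; have -> : i == 0 = false by lia.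
have pN i : ~~ code_set w i -> p i = i - rank w i - (i < n.+3 - j).
  by case: i => [//|i] Di; rewrite /p /decode (negbTE Di).
have N0 i : ~~ code_set w i -> 0 < i by case: i.
have rk0 : rank w 0 = 0 by rewrite /rank take0.
have rk1 : rank w 1 = 0 by rewrite /rank take0.
have rk2 : rank w 2 = 0 by rewrite /rank take0.
have rkn : rank w n.+3 = r by apply: rank_count; lia.
have rki i : rank w i <= i.-1.
  by case: i => [|[|i]]; rewrite ?rk0 ?rk1 //; have := @rank_le w 2 i.+2; rewrite rk2; lia.
have rkT i : 0 < i -> i < n.+3 -> ~~ code_set w i -> r + i < rank w i + n.+3.
  by move=> i0 lin Di; rewrite -rkn; apply: rank_gap.
have pDlt i : 0 < i -> i < n.+3 -> code_set w i -> n.+2 - r < p i < n.+3.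
  move=> i0 lin Di; have /andP[i1 _] := code_set_lt i0 Di.
  rewrite pD //; have := rank_lt i1 lin Di; rewrite rkn; lia.
have pNle i : i < n.+3 -> ~~ code_set w i -> p i <= n.+2 - r.
  move=> lin Di; rewrite pN //; have := rkT i (N0 _ Di) lin Di; lia.
split; last first.
  move=> [|i] lin; first by rewrite p0 /a; lia.
  have i0 : 0 < i.+1 by [].
  by case: (boolP (code_set w i.+1)) => Di; [have := pDlt _ i0 lin Di|have := pNle _ lin Di]; lia.
split.
- split=> //; [rewrite /a; lia | rewrite /a; lia |].
  by rewrite pN // rk1; lia.
- move=> [|i] lin //=; have i0 : 0 < i.+1 by [].
  case: (boolP (code_set w i.+1)) => Di; [have := pDlt _ i0 lin Di|have := pNle _ lin Di];
  rewrite /a; lia.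
- move=> [|i] k ik lkn Di Dk.
    by rewrite p0; have := pDlt k ik lkn Dk; rewrite /a; lia.
  have /andP[i1 _] := @code_set_lt w i.+1 isT Di.
  by have := rank_lt i1 ik Di; rewrite !pD //; lia.
- move=> i k ik lkn Di Dk; rewrite !pN //.
  have := rank_gap (N0 _ Di) ik Di; have := rki i; have := N0 _ Di; lia.
move=> i lin Di; rewrite pN //; have := rki i.
have := rkT i (N0 _ Di) lin Di.
case: (ltnP i (n.+3 - j)) => h; last first.
  rewrite rank_count; last by lia.
  by move=> *; right; rewrite /a -/r; lia.
(* Before the last [j] places, comparison with the place [n.+3 - j] bounds the value below a. *)
have rkj : rank w (n.+3 - j) <= r by have := @rank_le w (n.+3 - j) n.+3; rewrite rkn; lia.
have := rank_gap (N0 _ Di) h Di.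
have [j0|j0] := posnP j; first by move=> *; left; rewrite /a; lia.
rewrite rank_count; last by lia.
by move=> *; left; rewrite /a -/r; lia.
Qed.

(** Every inversion leads from [D] to its complement, which excludes 321. In a 21354 the 3 would be
    off [D] with a value above [a], hence among the last [j] places, yet followed by the 5, which is
    in [D]. *)
Lemma shaped_in_F n j a D p : 2 < n -> natperm n p -> shaped n j a D p ->
  (0 < j -> forall i, n - j <= i -> ~~ D i) ->
  (0 < j -> exists i, [/\ 0 < i, D i, forall k, 0 < k -> k < i -> ~~ D k & ~~ D i.+1]) ->
  in_F n p.
Proof.
move=> n2 [bp ip sp] [[p0 a0 lt p1] Dp incD incN Nval] Dj iso.
have D0 : D 0 by rewrite Dp //; lia.
have inv i k : i < k -> k < n -> p k < p i -> D i /\ ~~ D k.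
  move=> ik kn gt; have := incD i k ik kn; have := incN i k ik kn.
  case: (boolP (D i)) => Di; case: (boolP (D k)) => Dk //= h1 h2.
  - by have := h2 isT isT; lia.
  - exfalso; move: Di Dk; rewrite !Dp //; lia.
  - by have := h1 isT isT; lia.
split.
- move=> i k ik kn e; have [|Di Dk] := inv i k ik kn; first by lia.
  have lin : i < n by lia.
  have [i0|i0] := posnP i; first by rewrite i0; lia.
  have gt : a + j < p i by move: Di; rewrite Dp //; lia.
  have := Nval k kn Dk; have := Dp k kn; rewrite (negbTE Dk) => h1 h2.
  (* Here [p k = a + j] and [p i] is the next value; for [j = 0] no place off [D] carries [a]. So
     [i] is the first place of [D] after 0, to which [iso] applies. *)
  have j0 : 0 < j by lia.
  have [f [f0 Df fmin Df1]] := iso j0.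
  have fi : f = i.
    case: (ltngtP f i) => // h; last by have := fmin i i0 h; rewrite Di.
    have := incD f i h lin Df Di; have := Dp f; rewrite Df; lia.
  rewrite -fi in lin *; have := Dp f.+1; rewrite (negbTE Df1); rewrite -fi in gt ik; lia.
- move=> i m k im mk kn v1 v2.
  have [Dm _] := inv m k mk kn v1.
  by have [|_] := inv i m im _ v2; rewrite ?Dm //; lia.
move=> x1 x2 x3 x4 x5 l12 l23 l34 l45 l5 v21 v13 v35 v54.
have [D4 D5] := inv x4 x5 l45 l5 v54.
have [|D1 D2] := inv x1 x2 l12 _ v21; first by lia.
have e5 : p x5 <= a + j by have := Dp x5 l5; rewrite (negbTE D5); lia.
have le1 : a <= p x1.
  have [->|x10] := posnP x1; first by lia.
  by have := Dp x1; rewrite D1; lia.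
have D3 : ~~ D x3 by rewrite Dp; lia.
have [|[_ h3]] : p x3 < a \/ a < p x3 /\ n - j <= x3 by apply: Nval => //; lia.
  by lia.
have j0 : 0 < j by lia.
by have := Dj j0 x4; rewrite D4; lia.
Qed.

Lemma decode_surj n c : c \in codes n ->
  exists2 s : 'S_n.+3, in_H n.+3 (valn s) & encode n.+3 (valn s) = c.
Proof.
case: c => j w cw; have [sh bnd] := decode_shaped cw.
set p := decode _ _ _ in sh bnd; set a := _ - _ - _ in sh; set D := code_set w in sh.
have [[p0 a0 lt p1] Dp incD incN Nval] := sh.
have D0 : D 0 by [].
have inj i k : i < k -> k < n.+3 -> p i = p k -> False.
  move=> ik kn e.
  have := incD i k ik kn; have := incN i k ik kn; have := Dp i; have := Dp k.
  case: (boolP (D k)) => Dk; case: (boolP (D i)) => Di /=; try by lia.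
  (* The remaining collision is between place 0 and a place off [D], where the value [a] never
     occurs. *)
  have := Nval k kn Dk; case: i ik e {Di} => [|i]; lia.
have [s sE] := perm_of_nat bnd inj.
have {sh}ss : shaped n.+3 j a D (valn s).
  split.
  - by rewrite !sE.
  - by move=> i lin; rewrite sE // Dp.
  - by move=> i k ik kn; rewrite !sE //; [apply: incD | lia].
  - by move=> i k ik kn; rewrite !sE //; [apply: incN | lia].
  - by move=> i lin; rewrite sE //; apply: Nval.
clear p p0 p1 Dp incD incN Nval bnd inj sE lt.
have np := natperm_valn s; set p := valn s in ss np.
have [[p0 _ lt p1] Dp incD incN Nval] := ss; have [bp ip sp] := np.
have := cw; rewrite mem_codes => /and3P[jn /eqP sw iso].
have n2 : 2 < n.+3 by [].
have Dlt i : 0 < i -> D i -> 1 < i < n.+3 - maxn j 1.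
  by move=> i0 /(code_set_lt i0); rewrite sw; lia.
have Dj : 0 < j -> forall i, n.+3 - j <= i -> ~~ D i.
  by move=> j0 i le; apply/negP => /Dlt; lia.
have Dl : ~~ D n.+2 by apply/negP => /Dlt; lia.
have Dnth i : nth false w i = D i.+2 by rewrite /D /code_set /= 2!subSS subn0.
have isoD : 0 < j ->
    exists i, [/\ 0 < i, D i, forall k, 0 < k -> k < i -> ~~ D k & ~~ D i.+1].
  move=> j0; have /isolated_firstP[i [h1 h2 h3]] : isolated_first w.
    by case/orP: iso => // /eqP; lia.
  exists i.+2; split; rewrite -?Dnth // => -[|[|k]] // _ ki.
  by rewrite -Dnth; apply: h2.
have pl : p n.+2 = a + j \/ j = 0 /\ p n.+2 < a.
  have := Dp n.+2; rewrite (negbTE Dl) => /(_ (ltnSn _)) /esym/negbT h.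
  have [j0|j0] := posnP j.
    by right; split=> //; have := Nval n.+2 _ Dl; lia.
  (* The value [a + j] is the largest off [D], so by monotonicity it stands at the last place; this
     makes the excess equal to [j]. *)
  left; have [k lk ek] := sp (a + j) lt.
  have k0 : k <> 0 by move=> e; move: ek; rewrite e p0; lia.
  have Dk : ~~ D k by rewrite Dp // ek; lia.
  case: (ltngtP k n.+2) => kl; [|lia|by rewrite -kl].
  by have := incN k n.+2 kl (ltnSn _) Dk Dl; lia.
have ltl : p n.+2 < n.+2.
  case: pl => [e|[_ h]]; last by lia.
  have [j0|j0] := posnP j.
    by have := Nval n.+2 (ltnSn _) Dl; lia.
  have [f [f0 Df _ _]] := isoD j0; have lf : f < n.+3 by have := Dlt f f0 Df; lia.
  by have := Dp f lf; have := bp f lf; rewrite Df; lia.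
have hH : in_H n.+3 p.
  split=> //; [exact: (shaped_in_F n2 np ss) | lia | by rewrite /=; lia].
have ej : excess n.+3 p = j by rewrite /excess /=; lia.
exists s => //; rewrite /encode -/p ej; congr pair.
apply: (@eq_from_nth _ false) => [|i]; rewrite size_mkseq ?sw; first by lia.
move=> lt_i; rewrite nth_mkseq // Dnth (in_H_lrmax n2 hH); last by lia.
by rewrite ej p0 Dp //; lia.
Qed.

(** * Final count *)

Lemma card_H n : (#|H_321_21354 n.+2|).+1 = 2 ^ n.+1.
Proof.
rewrite -size_codes; congr _.+1.
have HP s : reflect (in_H n.+3 (valn s)) (s \in H_321_21354 n.+2).
  apply: (iffP setIdP) => [[/in_FP Fs /andP[/eqP h0 /eqP hl]]|[_ Fs h0 hl]].
    by split=> //; apply: natperm_valn.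
  by split; [apply/in_FP | apply/andP; split; apply/eqP].
apply: (@card_code _ _ _ (fun s => encode n.+3 (valn s))).
- exact: uniq_codes.
- move=> s t /HP hs /HP ht e; apply: valn_inj; exact: (encode_inj _ hs ht e).
- by move=> s /HP/encode_mem.
by move=> c /decode_surj[s hs <-]; exists s => //; apply/HP.
Qed.

Lemma card_F_small n : n < 2 -> #|F_321_21354 n.+1| = (n.+1)`!.
Proof.
move=> n2; rewrite -(card_Sn n.+1) -cardsT; congr #|pred_of_set _|.
apply/setP => s; rewrite in_setT; apply/in_FP; split.
(* With at most two places, [k] is [i.+1], so the pair is itself a descent. *)
- by move=> i k ik kn e; rewrite e (_ : i.+1 = k) //; lia.
- by move=> i j k; lia.
- by move=> x1 x2 x3 x4 x5; lia.
Qed.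

Theorem mainTheorem17 (n : nat) : (1 <= n)%N ->
  #|F_321_21354 n| + 'C(n, 2) + 1 = 2 ^ n.
Proof.
case: n => // n _; elim/ltn_ind: n => -[|[|n]] IH.
- by rewrite card_F_small.
- by rewrite card_F_small.
(* The recurrence prescribes the second difference [2 ^ n.+1 - 1]; the power of 2 contributes
   [2 ^ n.+1] and the binomial coefficient 1. *)
have := IH n.+1 (ltnSn _); have := IH n (leqnSn n.+1).
have := card_F_rec n; have := card_H n.
rewrite !binS !bin1 !bin0 !expnS; lia.
Qed.
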